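(* Let $\mathcal{G}=(\mathcal{V},\mathcal{E},A)$ be a weighted digraph on $n$ nodes that is strongly connected, with graph Laplacian $L$. For $i=1,\dots,n$ let $f_i:\mathbb{R}\to\mathbb{R}$ be an increasing (not necessarily continuous, not necessarily strictly increasing) function with $\lim_{x_i\to\infty}|f_i(x_i)|=\infty$. Then every solution $x:[0,\infty)\to\mathbb{R}^n$ of the differential inclusion $$\dot x(t)\in -L\left(\mathcal{F}[f_1](x_1(t))\times\cdots\times\mathcal{F}[f_n](x_n(t))\right)$$ converges asymptotically (as $t\to\infty$, in the sense that its distance to the set tends to $0$) to the set $$\mathcal{D}_1=\{x\in\mathbb{R}^n \mid \exists a\in\mathbb{R}\ \text{such that}\ a\mathbf{1}_n\in \mathcal{F}[f_1](x_1)\times\cdots\times\mathcal{F}[f_n](x_n)\}.$$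
   Context: Weighted digraph: node set $\mathcal{V}=\{v_1,\dots,v_n\}$, edge set $\mathcal{E}\subseteq\mathcal{V}\times\mathcal{V}$, adjacency matrix $A=[a_{ij}]$ with $a_{ij}\ge 0$, $a_{ii}=0$, and $a_{ij}>0$ if and only if $(v_j,v_i)\in\mathcal{E}$. The graph Laplacian is $L=\Delta-A$, where $\Delta$ is diagonal with $\Delta_{ii}=\sum_{j}a_{ij}$. The digraph is strongly connected if for every two nodes $v_i,v_j$ there is a directed path from $v_i$ to $v_j$. $\mathbf{1}_n$ is the all-ones vector in $\mathbb{R}^n$. For a map $X:\mathbb{R}^m\to\mathbb{R}^m$ the Filippov set-valued map is $\mathcal{F}[X](x)=\bigcap_{\delta>0}\bigcap_{\mu(S)=0}\overline{\mathrm{co}}\{X(B(x,\delta)\setminus S)\}$, where $B(x,\delta)$ is the open ball, $\mu$ is Lebesgue measure and $\overline{\mathrm{co}}$ is the closed convex hull. A solution of a differential inclusion is a (locally) absolutely continuous function satisfying the inclusion for almost every $t$. *)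

(* Defs.v *)
From HB Require Import structures.
From mathcomp Require Import all_boot all_order all_algebra.
From mathcomp Require Import all_classical all_reals all_analysis.

Set Implicit Arguments.
Unset Strict Implicit.
Unset Printing Implicit Defensive.

Import Order.TTheory GRing.Theory Num.Theory.
Import numFieldNormedType.Exports.

Local Open Scope classical_set_scope.
Local Open Scope ring_scope.

(* [edge j i] stands for $(v_j, v_i) \in E$: row [i] of the adjacency matrix
   collects the weights of the edges entering [v_i]. *)
Record weighted_digraph (R : realType) (n : nat) := WeightedDigraph {
  edge : rel 'I_n;
  adjacency : 'M[R]_n;
  adjacency_ge0 : forall i j, 0 <= adjacency i j;
  adjacency_diag : forall i, adjacency i i = 0;
  adjacency_gt0 : forall i j, (0 < adjacency i j) = edge j i
}.

Definition strongly_connected (R : realType) (n : nat)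
    (G : weighted_digraph R n) : Prop :=
  forall i j : 'I_n, connect (edge G) i j.

Definition laplacian (R : realType) (n : nat) (G : weighted_digraph R n) :
    'M[R]_n :=
  diag_mx (\row_i \sum_j adjacency G i j) - adjacency G.

Definition closed_convex_hull (R : realType) (V : normedModType R)
    (A : set V) : set V :=
  closure (smallest (@convex_set R V) A).

(* Filippov set-valued map of [f], in dimension one. [mu.-negligible S] says
   that [S] is included in a Borel set of measure zero, i.e. that [S] is a
   Lebesgue null set, Borel or not. *)
Definition filippov (R : realType) (f : R -> R) (x : R) : set R :=
  \bigcap_(d in [set d : R | 0 < d])
    \bigcap_(S in [set S : set R | (@lebesgue_measure R).-negligible S])
      @closed_convex_hull R R^o (f @` (ball x d `\` S)).

Definition filippov_prod (R : realType) (n : nat) (f : 'I_n -> R -> R)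
    (x : 'cV[R]_n) : set 'cV[R]_n :=
  [set y | forall i, filippov (f i) (x i 0) (y i 0)].

Definition abs_continuous (R : realType) (V : normedModType R) (a b : R)
    (x : R -> V) : Prop :=
  forall e : R, 0 < e -> exists2 d : R, 0 < d &
    forall (k : nat) (u v : 'I_k -> R),
      (forall i, [/\ a <= u i, u i <= v i & v i <= b]) ->
      trivIset [set: 'I_k] (fun i => `]u i, v i[%classic) ->
      \sum_(i < k) (v i - u i) < d ->
      \sum_(i < k) `|x (v i) - x (u i)| < e.

(* Solution on $[0, +\infty)$ of $\dot x \in \Phi(x)$; the values of [x] at
   negative times are irrelevant. *)
Definition inclusion_solution (R : realType) (V : normedModType R)
    (Phi : V -> set V) (x : R -> V) : Prop :=
  (forall a b : R, 0 <= a -> a <= b -> abs_continuous a b x) /\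
  {ae @lebesgue_measure R, forall t : R,
     0 <= t -> derivable x t 1 /\ Phi (x t) ('D_1 x t)}.

(* [edist_inf D] takes values in \bar R and is +oo everywhere when [D] is empty.
   For V = 'cV[R]_n the norm is the max norm; since all norms on R^n are
   equivalent, convergence to [D] is the same as for the Euclidean norm. *)
Definition converges_to_set (R : realType) (V : normedModType R)
    (x : R -> V) (D : set V) : Prop :=
  edist_inf D (x t) @[t --> +oo] --> 0%E.

Definition consensus_set (R : realType) (n : nat) (f : 'I_n -> R -> R) :
    set 'cV[R]_n :=
  [set x | exists a : R, filippov_prod f x (const_mx a)].

(* Main.v *)
(** The Lyapunov function is [V p = \sum_i w i * F i (p i)], where [w > 0] is a
    left null vector of the Laplacian and [F i] is a primitive of [f i].  Since
    [F i] is convex with subdifferential the Filippov set of [f i], the left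
    upper derivative of [V (x t)] is almost everywhere at most [y . x'(t)] for
    every Filippov selection [y]; for the one with [x' = - L y] this equals
    [- 1/2 \sum_(i, j) w i * a_ij * (y i - y j)^2].  Bounding left derivatives
    from above is enough for an absolutely continuous function to decrease, so
    differentiability of [V (x t)] is never needed.  [\sum_i w i * x i] is
    conserved and [F i] grows superlinearly at [+oo], so trajectories are
    bounded, hence Lipschitz.  By compactness the dissipation is bounded away
    from zero at distance at least [e] from the consensus set; each late visit
    at distance [2 e] lasts long enough to cost a fixed amount of [V], which is
    bounded below. *)

Require Import Defs.
From HB Require Import structures.
From mathcomp Require Import all_boot all_order all_algebra.
From mathcomp Require Import all_classical all_reals all_analysis.
From mathcomp Require Import measurable_realfun.
From mathcomp Require Import lra ring.
Set Implicit Arguments.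
Unset Strict Implicit.
Unset Printing Implicit Defensive.
Import Order.TTheory GRing.Theory Num.Theory.
Import numFieldNormedType.Exports.
Local Open Scope classical_set_scope.
Local Open Scope ring_scope.

(** * Monotonicity of absolutely continuous functions *)

(** The supremum of this set is the variation of [phi] over the part of [U] in [[a, s]]. Inclusion
    in [U] is asked of the open intervals only, and the empty family is allowed, so the set always
    contains 0. *)
Definition variation_sums (R : realType) (phi : R -> R) (U : set R) (a s : R) :
    set R :=
  [set r | exists k (u v : 'I_k -> R),
     [/\ forall i, [/\ a <= u i, u i <= v i & v i <= s],
         trivIset [set: 'I_k] (fun i => `]u i, v i[%classic),
         forall i, `]u i, v i[%classic `<=` U
       & r = \sum_(i < k) `|phi (v i) - phi (u i)|]].

Lemma variation_sums0 (R : realType) (phi : R -> R) U a s :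
  variation_sums phi U a s 0.
Proof.
exists 0%N, (fun=> 0), (fun=> 0); split => [[]//|[]//|[]//|].
by rewrite big_ord0.
Qed.

Lemma variation_sums_mono (R : realType) (phi : R -> R) U a s t :
  s <= t -> variation_sums phi U a s `<=` variation_sums phi U a t.
Proof.
move=> st r [k [u [v [uv tI uvU ->]]]]; exists k, u, v; split => // i.
by have [au ui vi] := uv i; split => //; exact: le_trans st.
Qed.

(** Superadditivity of the variation: []s, t[] lies to the right of every interval of a family in
    [[a, s]], so inserting it at index [ord0] keeps the family disjoint. *)
Lemma variation_sums_step (R : realType) (phi : R -> R) U a s t r :
  a <= s -> s <= t -> `]s, t[%classic `<=` U -> variation_sums phi U a s r ->
  variation_sums phi U a t (r + `|phi t - phi s|).
Proof.
move=> as_ st stU [k [u [v [uv tI uvU ->]]]].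
pose u' (i : 'I_k.+1) := if unlift ord0 i is Some j then u j else s.
pose v' (i : 'I_k.+1) := if unlift ord0 i is Some j then v j else t.
have disj j : `]u j, v j[%classic `&` `]s, t[%classic = set0.
  rewrite -subset0 => z [/=]; rewrite !in_itv/= => /andP[_ zv] /andP[sz _].
  by have [_ _ vs] := uv j; move: (lt_le_trans zv vs); rewrite ltNge (ltW sz).
exists k.+1, u', v'; split.
- move=> i; rewrite /u' /v'; case: unliftP => [j _|_] //.
  by have [? ? vs] := uv j; split => //; exact: le_trans st.
- apply/trivIsetP => i j _ _; rewrite /u' /v'.
  case: (unliftP ord0 i) => [i' ->|->]; case: (unliftP ord0 j) => [j' ->|->].
  + by rewrite (inj_eq lift_inj) => ij; move/trivIsetP : tI; exact.
  + by move=> _; exact: disj.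
  + by move=> _; rewrite setIC; exact: disj.
  + by rewrite eqxx.
- by move=> i; rewrite /u' /v'; case: unliftP => [j _|_].
- rewrite big_ord_recl /u' /v' unlift_none addrC; congr (_ + _).
  by apply: eq_bigr => i _; rewrite liftK.
Qed.

(** The sum of the lengths is the measure of the disjoint union, which is contained in [U]; this
    links the smallness of [U] to the definition of absolute continuity. *)
Lemma sum_disjoint_itv_le (R : realType) (U : set R) (k : nat) (u v : 'I_k -> R) :
  open U -> (forall i, u i <= v i) ->
  trivIset [set: 'I_k] (fun i => `]u i, v i[%classic) ->
  (forall i, `]u i, v i[%classic `<=` U) ->
  ((\sum_(i < k) (v i - u i))%:E <= lebesgue_measure U)%E.
Proof.
move=> oU uv tI uvU.
have -> : ((\sum_(i < k) (v i - u i))%:E =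
    lebesgue_measure (\big[setU/set0]_(i < k) `]u i, v i[%classic))%E.
  rewrite measure_bigsetU_ord//= -sumEFin; apply: eq_bigr => i _.
  rewrite lebesgue_measure_itv/= lte_fin; have := uv i; rewrite le_eqVlt.
  by case: ltP => //= vu /predU1P[->|]; rewrite ?subrr// ltNge vu.
apply: le_measure; rewrite ?inE//=.
- by apply: bigsetU_measurable => i _.
- exact: open_measurable.
- by elim/big_ind : _ => // A B AU BU; rewrite subUset.
Qed.

(* Cover the exceptional set by an open set [U] of small measure and let [W s]
   be the variation of [phi] over [U] on [[a, s]]; then [phi s - e * s - W s]
   does not decrease when [s] moves left from [b] to [a]. *)
Lemma abs_continuous_slope_le0 (R : realType) (a b : R) (phi : R -> R) (N : set R) :
  a <= b -> abs_continuous a b (phi : R -> R^o) ->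
  (@lebesgue_measure R).-negligible N ->
  (forall t, a < t -> t <= b -> ~ N t -> forall e, 0 < e ->
     exists2 d, 0 < d &
       forall s, t - d < s -> s < t -> phi t - phi s <= e * (t - s)) ->
  phi b <= phi a.
Proof.
move=> ab ac [M [mM M0 NM]] slope.
rewrite -subr_le0; apply/ler_addgt0Pr => e0 e0_gt0; rewrite add0r.
(* The slope will cost [e * (b - a)] and the variation over [U] at most [e], in total [e0]. *)
pose e := e0 / (b - a + 1).
have e_gt0 : 0 < e by rewrite divr_gt0// ltr_wpDl// subr_ge0.
have e0E : e0 = e * (b - a) + e.
  by rewrite -[X in _ + X]mulr1 -mulrDr /e divfK// gt_eqF// ltr_wpDl// subr_ge0.
have [d d_gt0 dP] := ac e e_gt0.
have [U [oU MU muU]] : exists U, [/\ open U, M `<=` U & (lebesgue_measure U < d%:E)%E].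
  have [|U [oU MU UM]] := @lebesgue_regularity_outer R M d mM _ d_gt0.
    by rewrite [X in (X < _)%E]M0.
  exists U; split => //; apply: le_lt_trans UM.
  rewrite -[in X in (X <= _)%E](setDUK MU) (le_trans (measureU2 _ _ _))//=.
  - exact: measurableD (open_measurable oU) mM.
  - by rewrite [X in (X + _)%E]M0 add0e.
have vub s : s <= b -> ubound (variation_sums phi U a s) e.
  move=> sb r [k [u [v [uv tI uvU ->]]]]; apply/ltW/dP => //.
    by move=> i; have [? ? vs] := uv i; split => //; exact: le_trans sb.
  rewrite -lte_fin; apply: le_lt_trans muU; apply: sum_disjoint_itv_le => // i.
  by have [] := uv i.
pose W s := sup (variation_sums phi U a s).
have hub s : s <= b -> has_ubound (variation_sums phi U a s) by exists e; exact: vub.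
have hsup s : s <= b -> has_sup (variation_sums phi U a s).
  by move=> sb; split; [exists 0; exact: variation_sums0|exact: hub].
have W_ge0 s : s <= b -> 0 <= W s.
  by move=> sb; apply: ub_le_sup; [exact: hub|exact: variation_sums0].
have W_le s : s <= b -> W s <= e.
  by move=> sb; apply: ge_sup; [exists 0; exact: variation_sums0|exact: vub].
have W_mono s t : s <= t -> t <= b -> W s <= W t.
  move=> st tb; apply: ge_sup; first by exists 0; exact: variation_sums0.
  move=> r /(variation_sums_mono st) h; apply: ub_le_sup => //; exact: hub.
have W_step s t : a <= s -> s <= t -> t <= b -> `]s, t[%classic `<=` U ->
    W s + `|phi t - phi s| <= W t.
  move=> as_ st tb stU; rewrite -lerBrDr; apply: ge_sup.
    by exists 0; exact: variation_sums0.
  move=> r h; rewrite lerBrDr; apply: ub_le_sup; first exact: hub.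
  exact: variation_sums_step h.
pose h s := phi s - e * s - W s.
pose A := [set s | a <= s <= b /\ h b <= h s].
have hA : has_inf A.
  by split; [exists b; rewrite /A/= ab lexx|exists a => s [/andP[]]].
have infA_ge : a <= inf A by apply: lb_le_inf => [|s [/andP[]]//]; case: hA.
have infA_le : inf A <= b.
  by apply: ge_inf; [case: hA|rewrite /A/= ab lexx].
(* [phi] is continuous, and [W] can only get smaller from [s] down to [inf A], which raises [h]; so
   the defining inequality survives in the limit. *)
have AinfA : A (inf A).
  split; first by rewrite infA_ge.
  apply/ler_addgt0Pr => r r_gt0.
  pose r1 := r / (`|e| + 1).
  have n1 : 0 < `|e| + 1 by rewrite ltr_wpDl.
  have r1_gt0 : 0 < r1 by rewrite divr_gt0.
  have [q q_gt0 qP] := ac (r / 2) ltac:(by rewrite divr_gt0).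
  pose p := Num.min q (r1 / 2).
  have p_gt0 : 0 < p by rewrite lt_min q_gt0 divr_gt0.
  have [s As sp] := inf_adherent p_gt0 hA.
  have As' := As.
  have infs : inf A <= s by apply: ge_inf => //; case: hA.
  have [/andP[as_ sb] hs] := As.
  have : `|phi s - phi (inf A)| < r / 2.
    have := qP 1%N (fun=> inf A) (fun=> s); rewrite !big_ord1; apply => //.
      by apply/trivIsetP => i j _ _; rewrite !ord1 eqxx.
    by rewrite ltrBlDl (lt_le_trans sp)// lerD2l ge_min lexx.
  rewrite ltr_norml => /andP[_ phis].
  have Wm := W_mono _ _ infs sb.
  have : e * (inf A - s) <= r / 2.
    apply: le_trans (ler_norm _) _; rewrite normrM.
    have : `|inf A - s| <= r1 / 2.
      rewrite distrC ger0_norm ?subr_ge0// lerBlDl; apply: (le_trans (ltW sp)).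
      by rewrite lerD2l ge_min lexx orbT.
    move=> /(ler_wpM2l (normr_ge0 e)) /le_trans; apply.
    rewrite mulrA ler_pM2r// /r1 mulrCA ler_piMr ?(ltW r_gt0)//.
    by rewrite ler_pdivrMr// mul1r lerDl.
  rewrite /h in hs *; lra.
(* At [a], the inequality [h b <= h a] with [0 <= W a] and [W b <= e] is the claim. If instead
   [a < inf A], a point further left still in [A] gives a contradiction. *)
suff Aa : A a.
  case: Aa => _; rewrite /h => hab.
  have := W_ge0 a ab; have := W_le b (lexx b); rewrite e0E; nra.
have [aA|a_lt] := eqVneq a (inf A); first by move: AinfA; rewrite -[in A _]aA.
have {}a_lt : a < inf A by rewrite lt_neqAle a_lt.
have [_ hinf] := AinfA.
exfalso.
suff [s [as_ sinf hs]] : exists s, [/\ a <= s, s < inf A & h (inf A) <= h s].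
  have : A s by split; [rewrite as_ (le_trans (ltW sinf))|exact: le_trans hs].
  by move=> /(ge_inf hA.2); rewrite leNgt sinf.
(* At an exceptional point a left neighbourhood lies in [U] and the increment of [W] absorbs that of
   [phi]; elsewhere the slope bound does it. *)
have [Nt|nNt] := pselect (N (inf A)).
- have /nbhs_ballP[q /= q_gt0 qU] : nbhs (inf A) U.
    by apply: open_nbhs_nbhs; split => //; exact/MU/NM.
  pose s := Num.max a (inf A - q / 2).
  have ss : s < inf A by rewrite /s gt_max a_lt ltrBlDr ltrDl divr_gt0.
  exists s; split => //; first by rewrite le_max lexx.
  have : W s + `|phi (inf A) - phi s| <= W (inf A).
    apply: W_step => //; [by rewrite le_max lexx|exact: ltW|].
    move=> z /=; rewrite in_itv/= gt_max => /andP[/andP[_ qz] zA]; apply: qU.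
    rewrite /ball/= ger0_norm ?subr_ge0 ?(ltW zA)//.
    by have : 0 < q := q_gt0; lra.
  have := ler_norm (phi (inf A) - phi s); rewrite /h.
  have : 0 <= e * (inf A - s) by rewrite mulr_ge0 ?subr_ge0 ?ltW.
  lra.
- have [q q_gt0 qP] := slope _ a_lt infA_le nNt e e_gt0.
  pose s := Num.max a (inf A - q / 2).
  have ss : s < inf A by rewrite /s gt_max a_lt ltrBlDr ltrDl divr_gt0.
  exists s; split => //; first by rewrite le_max lexx.
  have := qP s ltac:(by rewrite /s lt_max; apply/orP; right; lra) ss.
  have := W_mono _ _ (ltW ss) infA_le; rewrite /h; lra.
Qed.

(** The Lipschitz bound is asked only between points of the curve, so a function [g] that is
    Lipschitz on bounded sets can be composed with a bounded [x]. *)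
Lemma abs_continuous_lipschitz (R : realType) (V W : normedModType R)
    (a b K : R) (x : R -> V) (g : R -> W) :
  abs_continuous a b x ->
  (forall s t, a <= s -> s <= t -> t <= b -> `|g t - g s| <= K * `|x t - x s|) ->
  abs_continuous a b g.
Proof.
move=> xac gK e e_gt0.
have K_gt0 : 0 < `|K| + 1 by rewrite ltr_wpDl.
have [d d_gt0 dP] := xac (e / (`|K| + 1)) ltac:(by rewrite divr_gt0).
exists d => // k u v uv tI uvd.
have := dP k u v uv tI uvd; rewrite ltr_pdivlMr// mulrC mulr_sumr; apply: le_lt_trans.
apply: ler_sum => i _; have [au ui vb] := uv i; apply: le_trans (gK _ _ au ui vb) _.
by apply: ler_wpM2r => //; rewrite (le_trans (ler_norm _))// lerDl.
Qed.

(** Subtracting [c * t] from [phi] reduces this to slope zero. *)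
Lemma abs_continuous_slope_le (R : realType) (a b c : R) (phi : R -> R) (N : set R) :
  a <= b -> abs_continuous a b (phi : R -> R^o) ->
  (@lebesgue_measure R).-negligible N ->
  (forall t, a < t -> t <= b -> ~ N t -> forall e, 0 < e ->
     exists2 d, 0 < d &
       forall s, t - d < s -> s < t -> phi t - phi s <= (c + e) * (t - s)) ->
  phi b - phi a <= c * (b - a).
Proof.
move=> ab ac N0 slope; pose psi t := phi t - c * t.
suff : psi b <= psi a by rewrite /psi; lra.
apply: (abs_continuous_slope_le0 ab _ N0) => [e e_gt0|t at_ tb Nt e e_gt0].
  have [d d_gt0 dP] := ac (e / 2) ltac:(by rewrite divr_gt0).
  have c_gt0 : 0 < `|c| + 1 by rewrite ltr_wpDl.
  exists (Num.min d (e / 2 / (`|c| + 1))).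
    by rewrite lt_min d_gt0 !divr_gt0.
  move=> k u v uv tI; rewrite lt_min => /andP[/(dP _ _ _ uv tI) Hphi].
  rewrite ltr_pdivlMr// mulr_suml => Hc; rewrite [e]splitr.
  apply: le_lt_trans (ltrD Hphi Hc); rewrite -big_split/=; apply: ler_sum => i _.
  have [_ ui _] := uv i.
  have -> : psi (v i) - psi (u i) = (phi (v i) - phi (u i)) - c * (v i - u i).
    by rewrite /psi; ring.
  apply: le_trans (ler_normB _ _) _; rewrite lerD2l normrM mulrC.
  by rewrite ger0_norm ?subr_ge0// ler_wpM2l ?subr_ge0// lerDl.
have [d d_gt0 dP] := slope t at_ tb Nt e e_gt0; exists d => // s ds st.
by have := dP s ds st; rewrite /psi; lra.
Qed.

(** * Primitives of monotone functions and the Perron vector *)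

Lemma nondecreasing_itv_integrable (R : realType) (f : R -> R) (a b : R) :
  {homo f : u v / u <= v} ->
  (@lebesgue_measure R).-integrable `]a, b] (EFin \o f).
Proof.
move=> f_nd; apply: measurable_bounded_integrable => //=.
- by rewrite lebesgue_measure_itv/=; case: ifP => // _; rewrite -EFinB ltry.
- exact: nondecreasing_measurable.
- exists (`|f a| + `|f b|); split; first exact: num_real.
  move=> M ltM x /=; rewrite in_itv/= => /andP[ax xb].
  have := f_nd _ _ (ltW ax); have := f_nd _ _ xb.
  have := ler_norm (f b); have := ler_norm (- f a); rewrite normrN ler_norml.
  have := normr_ge0 (f a); have := normr_ge0 (f b); move: ltM; set fx := f x; lra.
Qed.

(** [F] is the integral of [f] from 0. All that is kept of it is that [f a] is a subgradient of [F]
    at [a], for [b] on either side of [a]. *)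
Lemma nondecreasing_primitive (R : realType) (f : R -> R) :
  {homo f : u v / u <= v} ->
  exists F : R -> R, forall a b, f a * (b - a) <= F b - F a.
Proof.
move=> f_nd.
pose I a b := \int[@lebesgue_measure R]_(t in `]a, b]) f t.
have intf a b := nondecreasing_itv_integrable a b f_nd.
have intc (r a b : R) : (@lebesgue_measure R).-integrable `]a, b] (EFin \o cst r).
  by apply: nondecreasing_itv_integrable => u v _ /=.
have Ic (r a b : R) : a <= b -> \int[@lebesgue_measure R]_(t in `]a, b]) r = r * (b - a).
  move=> ab; rewrite Rintegral_cst//= lebesgue_measure_itv/= lte_fin.
  move: ab; rewrite le_eqVlt => /predU1P[->|->//]; by rewrite ltxx subrr.
have I0 a b : b <= a -> I a b = 0.
  by move=> ba; rewrite /I set_itv_ge ?Rintegral_set0// bnd_simp -leNgt.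
have ID a b c : a <= b -> b <= c -> I a c - I a b = I b c.
  by move=> ab bc; apply: Rintegral_itvB => //; rewrite bnd_simp.
have I_ge a b : a <= b -> f a * (b - a) <= I a b.
  move=> ab; rewrite -Ic//; apply: le_Rintegral => //=; first exact: intc.
  by move=> x; rewrite in_itv/= => /andP[ax _]; exact/f_nd/ltW.
have I_le a b : a <= b -> I a b <= f b * (b - a).
  move=> ab; rewrite -Ic//; apply: le_Rintegral => //=; first exact: intc.
  by move=> x; rewrite in_itv/= => /andP[_ xb]; exact/f_nd.
(* One of the two integrals runs over an empty interval, so this is the signed integral from 0 to
   [x]. *)
pose F x := I 0 x - I x 0.
have FB a b : a <= b -> F b - F a = I a b.
  move=> ab; rewrite /F; have [a0|a0] := leP 0 a.
    rewrite (I0 _ _ a0) (I0 b 0) ?(le_trans a0)// -(ID 0 a b)//; ring.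
  have [b0|b0] := leP 0 b.
    rewrite (I0 _ _ (ltW a0)) (I0 _ _ b0) -(ID a 0 b) ?(ltW a0)//; ring.
  rewrite (I0 _ _ (ltW a0)) (I0 _ _ (ltW b0)) -(ID a b 0) ?(ltW b0)//; ring.
exists F => a b; have [ab|/ltW ba] := leP a b; first by rewrite FB//; exact: I_ge.
by have := I_le _ _ ba; rewrite -FB//; lra.
Qed.

Lemma laplacianE (R : realType) (n : nat) (G : weighted_digraph R n) (y : 'cV[R]_n) i :
  (laplacian G *m y) i 0 = \sum_j adjacency G i j * (y i 0 - y j 0).
Proof.
rewrite /laplacian mulmxBl mul_diag_mx !mxE mulr_suml -sumrB.
by apply: eq_bigr => j _; rewrite mulrBr.
Qed.

(** The all-ones vector is in the kernel of the Laplacian, so a nonzero left null vector [v] exists.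
    Its entrywise absolute value is again a left null vector, and strong connectivity excludes zero
    entries. *)
Lemma left_perron_vector (R : realType) (n : nat) (G : weighted_digraph R n) :
  strongly_connected G ->
  exists2 w : 'I_n -> R, (forall i, 0 < w i) &
    forall j, \sum_i w i * adjacency G i j = w j * \sum_i adjacency G j i.
Proof.
case: n G => [|n] G Gc; first by exists (fun=> 0) => -[].
have /det0P[v v0 vL] : \det (laplacian G) == 0.
  rewrite -det_tr; apply/det0P; exists (const_mx 1).
    by apply/eqP => /rowP/(_ 0); rewrite !mxE => /eqP; rewrite oner_eq0.
  apply: trmx_inj; rewrite trmx_mul trmxK trmx0; apply/colP => i.
  by rewrite laplacianE big1 ?mxE// => j _; rewrite !mxE subrr mulr0.
pose d j := \sum_i adjacency G j i.
have d_ge0 j : 0 <= d j by apply: sumr_ge0 => i _; exact: adjacency_ge0.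
have vE j : \sum_i v 0 i * adjacency G i j = v 0 j * d j.
  move/rowP : vL => /(_ j); rewrite /laplacian mulmxBr mul_mx_diag !mxE.
  by move/eqP; rewrite subr_eq0 => /eqP <-.
pose w j := `|v 0 j|.
have w_le j : w j * d j <= \sum_i w i * adjacency G i j.
  rewrite -[d j]ger0_norm// /w -normrM -vE (le_trans (ler_norm_sum _ _ _))//.
  by apply: ler_sum => i _; rewrite normrM (ger0_norm (adjacency_ge0 _ _ _)).
have w_sum : \sum_j w j * d j = \sum_j \sum_i w i * adjacency G i j.
  by rewrite exchange_big/=; apply: eq_bigr => i _; rewrite mulr_sumr.
(* The inequalities [w_le] add up to an equality, so each of them is one. *)
have wE j : \sum_i w i * adjacency G i j = w j * d j.
  move/eqP : w_sum; rewrite eq_sym -subr_eq0 -sumrB psumr_eq0.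
    by move=> /allP/(_ j (mem_index_enum _)); rewrite subr_eq0 => /eqP.
  by move=> i _; rewrite subr_ge0.
(* A zero of [w] propagates forward along edges: at a zero [j] all the nonnegative terms
   [w i * adjacency G i j] vanish. *)
have w_edge i j : edge G j i -> w j = 0 -> w i = 0.
  move=> ji wj0; have := wE j; rewrite wj0 mul0r => /eqP.
  rewrite psumr_eq0 => [|k _]; last by rewrite mulr_ge0 ?adjacency_ge0 ?normr_ge0.
  move=> /allP/(_ i (mem_index_enum _)); rewrite mulf_eq0 => /orP[/eqP//|/eqP a0].
  by have := adjacency_gt0 G i j; rewrite ji a0 ltxx.
have w_conn i j : connect (edge G) j i -> w j = 0 -> w i = 0.
  move=> /connectP[p + ->]; elim: p j => //= k p IH j /andP[jk kp] wj.
  by apply: IH kp _; exact: w_edge jk wj.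
exists w => // i; rewrite lt_neqAle normr_ge0 andbT eq_sym; apply/eqP => wi.
move/eqP : v0; apply; apply/rowP => j; rewrite mxE; apply/normr0_eq0.
exact: w_conn (Gc i j) wi.
Qed.

(** Expand the square. Since [w] is a left null vector, the sums of [y i ^+ 2] and of [y j ^+ 2]
    against [w i * adjacency G i j] agree. *)
Lemma dissipation (R : realType) (n : nat) (G : weighted_digraph R n)
    (w y : 'I_n -> R) :
  (forall j, \sum_i w i * adjacency G i j = w j * \sum_i adjacency G j i) ->
  \sum_i w i * (y i * \sum_j adjacency G i j * (y i - y j)) =
  2^-1 * \sum_i \sum_j w i * adjacency G i j * (y i - y j) ^+ 2.
Proof.
move=> wE.
have sq : \sum_i \sum_j w i * adjacency G i j * (y j) ^+ 2 =
          \sum_i \sum_j w i * adjacency G i j * (y i) ^+ 2.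
  rewrite exchange_big/=; apply: eq_bigr => j _.
  by rewrite -mulr_suml wE -mulr_suml mulr_sumr.
pose S1 := \sum_i \sum_j w i * adjacency G i j * (y i) ^+ 2.
pose S2 := \sum_i \sum_j w i * adjacency G i j * (y i * y j).
have -> : \sum_i w i * (y i * \sum_j adjacency G i j * (y i - y j)) = S1 - S2.
  rewrite -sumrB; apply: eq_bigr => i _; rewrite -sumrB !mulr_sumr.
  by apply: eq_bigr => j _; ring.
have -> : \sum_i \sum_j w i * adjacency G i j * (y i - y j) ^+ 2 = S1 - S2 *+ 2 + S1.
  rewrite -[X in _ = _ + X]sq -sumrMnl -sumrB -big_split/=; apply: eq_bigr => i _.
  rewrite -sumrMnl -sumrB -big_split/=; apply: eq_bigr => j _; ring.
by field.
Qed.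

Lemma dissipation_eq0 (R : realType) (n : nat) (G : weighted_digraph R n)
    (w y : 'I_n -> R) :
  strongly_connected G -> (forall i, 0 < w i) ->
  \sum_i \sum_j w i * adjacency G i j * (y i - y j) ^+ 2 = 0 ->
  exists a, forall i, y i = a.
Proof.
case: n G w y => [|n] G w y Gc w_gt0; first by exists 0 => -[].
have t_ge0 i j : 0 <= w i * adjacency G i j * (y i - y j) ^+ 2.
  by rewrite mulr_ge0 ?sqr_ge0// mulr_ge0 ?adjacency_ge0// ltW.
move=> /eqP; rewrite psumr_eq0 => [/allP S0|i _]; last exact: sumr_ge0.
have y_edge i j : edge G j i -> y i = y j.
  move=> ji; have /= := S0 i (mem_index_enum _); rewrite psumr_eq0//.
  move=> /allP/(_ j (mem_index_enum _)); rewrite -adjacency_gt0 in ji.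
  by rewrite mulf_eq0 gt_eqF ?mulr_gt0//= sqrf_eq0 subr_eq0 => /eqP.
exists (y ord0) => i; have /connectP[p + ->] := Gc ord0 i.
elim: p (ord0) => //= k p IH j /andP[jk kp]; by rewrite IH// (y_edge _ _ jk).
Qed.

(** * Filippov sets of monotone functions *)

Lemma closed_convex_hull_sub (R : realType) (V : normedModType R) (A B : set V) :
  closed B -> @convex_set R V B -> A `<=` B -> closed_convex_hull A `<=` B.
Proof.
move=> cB vB AB; rewrite /closed_convex_hull [B in _ `<=` B](closure_id _).1//.
by apply: closure_subset; apply: smallest_sub.
Qed.

(* [y] lies between the one-sided limits of [f] at [x], for nondecreasing [f]. *)
Definition monotone_graph (R : realType) (f : R -> R) (x y : R) : Prop :=
  (forall u, u < x -> f u <= y) /\ (forall u, x < u -> y <= f u).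

Lemma negligible_itv_avoid (R : realType) (S : set R) (a b : R) :
  a < b -> (@lebesgue_measure R).-negligible S ->
  exists2 z, a < z < b & ~ S z.
Proof.
move=> ab [M [mM M0 SM]]; apply: contrapT => avoid.
have : (lebesgue_measure `]a, b[%classic <= lebesgue_measure M)%E.
  apply: le_measure; rewrite ?inE//= => z /=; rewrite in_itv/= => zab.
  by apply: SM; apply: contrapT => nSz; apply: avoid; exists z.
rewrite [X in (_ <= X)%E]M0 lebesgue_measure_itv/= lte_fin ab lee_fin.
by rewrite subr_le0 leNgt ab.
Qed.

(** Left to right, the ball of radius [|x - u|] with no point removed is mapped into a closed
    half-line bounded by [f u]. Conversely, points [p < x < q] of the ball outside the null set give
    [f p <= y <= f q], so [y] is already in the convex hull. *)
Lemma filippovE (R : realType) (f : R -> R) (x y : R) :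
  {homo f : u v / u <= v} -> filippov f x y <-> monotone_graph f x y.
Proof.
move=> f_nd; split.
  move=> fxy.
  have S0 : (@lebesgue_measure R).-negligible set0 by exact: negligible_set0.
  split => u ux.
  - have := fxy (x - u) ltac:(by rewrite /= subr_gt0) _ S0.
    apply: (@closed_convex_hull_sub R R^o _ [set z | f u <= z]).
    + exact: closed_ge.
    + move=> a b l; rewrite !inE/= => fa fb.
      have -> : conv l a b = l%:num * a + (1 - l%:num) * b :> R by [].
      have l0 : 0 <= l%:num by exact: ge0.
      have l1 : l%:num <= 1 by exact: le1.
      have := mulr_ge0 l0 (_ : 0 <= (a : R) - f u).
      have := mulr_ge0 (_ : 0 <= 1 - l%:num) (_ : 0 <= (b : R) - f u).
      by rewrite !subr_ge0 => /(_ l1 fb) h1 /(_ fa) h2; lra.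
    + move=> _ [z [+ _] <-] /=; rewrite /ball/= => xz.
      by apply: f_nd; have := ler_norm (x - z); lra.
  - have := fxy (u - x) ltac:(by rewrite /= subr_gt0) _ S0.
    apply: (@closed_convex_hull_sub R R^o _ [set z | z <= f u]).
    + exact: closed_le.
    + move=> a b l; rewrite !inE/= => fa fb.
      have -> : conv l a b = l%:num * a + (1 - l%:num) * b :> R by [].
      have l0 : 0 <= l%:num by exact: ge0.
      have l1 : l%:num <= 1 by exact: le1.
      have := mulr_ge0 l0 (_ : 0 <= f u - (a : R)).
      have := mulr_ge0 (_ : 0 <= 1 - l%:num) (_ : 0 <= f u - (b : R)).
      by rewrite !subr_ge0 => /(_ l1 fb) h1 /(_ fa) h2; lra.
    + move=> _ [z [+ _] <-] /=; rewrite /ball/= => xz.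
      by apply: f_nd; have := ler_norm (z - x); rewrite distrC; lra.
move=> [fx xf] d /= d_gt0 S S0; apply: subset_closure.
have [p /andP[dp px] nSp] := negligible_itv_avoid (ltac:(lra) : x - d < x) S0.
have [q /andP[xq qd] nSq] := negligible_itv_avoid (ltac:(lra) : x < x + d) S0.
move=> C [vC imC].
have Cp : C (f p).
  by apply: imC; exists p => //; split => //; rewrite /ball/= gtr0_norm; lra.
have Cq : C (f q).
  by apply: imC; exists q => //; split => //; rewrite /ball/= ltr0_norm; lra.
have py := fx _ px; have yq := xf _ xq.
have [pq|pq] := eqVneq (f p) (f q).
  by have -> : y = f p; [lra|].
have {}pq : 0 < f q - f p by rewrite subr_gt0 lt_neqAle pq (le_trans py).
pose c := (f q - y) / (f q - f p).
have c0 : 0 <= c by rewrite /c divr_ge0 ?subr_ge0// -subr_ge0 ltW.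
have c1 : c <= 1 by rewrite /c ler_pdivrMr// mul1r lerD2l lerN2.
have := vC (f p) (f q) (Itv01 c0 c1); rewrite !inE => /(_ Cp Cq).
have -> // : conv (Itv01 c0 c1) (f p : convex_lmodType R^o) (f q) =
    c * f p + (1 - c) * f q :> R by [].
by have -> : c * f p + (1 - c) * f q = y by rewrite /c; field; rewrite gt_eqF.
Qed.

(** For [u] between [x] and [z], add the subgradient inequalities from [x] to [u] and from [u] to
    [z]. Replacing [f u] by [y] is favourable, and replacing [f x] by [y] costs an error that
    vanishes as [u] tends to [x]. *)
Lemma primitive_subgradient (R : realType) (f F : R -> R) (x y z : R) :
  (forall a b, f a * (b - a) <= F b - F a) ->
  monotone_graph f x y -> y * (z - x) <= F z - F x.
Proof.
move=> Ff [fx xf].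
have [->|zx] := eqVneq z x; first by rewrite !subrr mulr0.
apply/ler_addgt0Pr => e e_gt0.
pose k := `|f x - y| + 1; pose m := `|z - x| + 1.
have k_gt0 : 0 < k by rewrite ltr_wpDl.
have m_gt0 : 0 < m by rewrite ltr_wpDl.
(* The first bound keeps [u] strictly between [x] and [z], the second makes the error at most
   [e]. *)
pose r := Num.min 2^-1 (e / (k * m)).
have r_gt0 : 0 < r by rewrite lt_min invr_gt0 ltr0n !(divr_gt0, mulr_gt0).
have r_lt1 : r < 1 by rewrite gt_min invf_lt1 ?ltr1n.
have rkm : r * m * k <= e.
  rewrite -mulrA -ler_pdivlMr ?mulr_gt0// [m * k]mulrC ge_min lexx orbT//.
pose u := x + r * (z - x).
have fu : 0 <= (f u - y) * (z - u).
  have [zx'|xz'|/eqP] := ltgtP z x; last by rewrite (negPf zx).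
  - have : f u <= y by apply: fx; rewrite /u; nra.
    have : z < u by rewrite /u; nra.
    nra.
  - have : y <= f u by apply: xf; rewrite /u; nra.
    have : u < z by rewrite /u; nra.
    nra.
have uE : `|(f x - y) * (u - x)| <= e.
  apply: le_trans rkm; rewrite /u addrAC subrr add0r normrM normrM (gtr0_norm r_gt0).
  rewrite mulrC ler_pM ?mulr_ge0 ?(ltW r_gt0)//; last by rewrite lerDl.
  by rewrite ler_pM2l// lerDl.
move: uE; rewrite ler_norml => /andP[uE _].
have := Ff u z; have := Ff x u; lra.
Qed.

Lemma primitive_lipschitz (R : realType) (f F : R -> R) (B a b : R) :
  {homo f : u v / u <= v} ->
  (forall a b, f a * (b - a) <= F b - F a) -> `|a| <= B -> `|b| <= B ->
  `|F b - F a| <= (`|f (- B)| + `|f B|) * `|b - a|.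
Proof.
move=> f_nd Ff.
have fK c : `|c| <= B -> `|f c| <= `|f (- B)| + `|f B|.
  rewrite !ler_norml => /andP[/f_nd h1 /f_nd h2].
  have := ler_norm (f B); have := ler_norm (- f (- B)); rewrite normrN.
  by have := normr_ge0 (f (- B)); have := normr_ge0 (f B); lra.
move=> /fK fa /fK fb; rewrite ler_norml.
have := Ff a b; have := Ff b a.
have h c : `|f c| <= `|f (- B)| + `|f B| ->
    `|f c * (b - a)| <= (`|f (- B)| + `|f B|) * `|b - a|.
  by move=> ?; rewrite normrM ler_wpM2r.
have := h _ fa; have := h _ fb; rewrite !ler_norml; lra.
Qed.

(** Two supporting lines of [F] suffice: the one at 0, of slope at most [l - 1], for negative [b],
    and one at some [z >= 0] of slope at least [l + 1] for the other [b]. The tilt [l * b] will sum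
    up to a conserved quantity. *)
Lemma primitive_coercive (R : realType) (f F : R -> R) (l : R) :
  {homo f : u v / u <= v} -> `|f z| @[z --> +oo] --> +oo ->
  (forall a b, f a * (b - a) <= F b - F a) -> f 0 + 1 <= l ->
  exists C, forall b, l * b + `|b| - C <= F b.
Proof.
move=> f_nd /cvgryPge f_oo Ff f0l.
(* The summand [|f 0|] forces [f z] to be positive, since [f 0 <= f z]. *)
have [z [fz z_ge0]] : exists z, `|f 0| + `|l + 1| + 1 <= `|f z| /\ 0 <= z.
  apply: (@filter_ex _ (+oo : set_system R)); near=> z; split; near: z.
    exact: f_oo.
  exact: nbhs_pinfty_ge.
have {fz}lfz : l + 1 <= f z.
  have := ler_norm (l + 1); have := ler_norm (- f 0); rewrite normrN.
  have := f_nd _ _ z_ge0; have := normr_ge0 (f 0); have := normr_ge0 (l + 1).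
  case: (ger0P (f z)) fz; lra.
exists (`|F 0| + `|F z - f z * z|) => b.
have := ler_norm (- F 0); have := ler_norm (- (F z - f z * z)); rewrite !normrN.
have := normr_ge0 (F 0); have := normr_ge0 (F z - f z * z).
have := Ff 0 b; have := Ff z b.
by case: (ger0P b) => b0; nra.
Unshelve. all: by end_near.
Qed.

(** Each implication from [u < g v] is the disjunction of two closed conditions on [v], so jumps of
    [f] do no harm. *)
Lemma closed_monotone_graph (R : realType) (T : topologicalType) (f : R -> R)
    (g h : T -> R) : continuous g -> continuous h ->
  closed [set v | monotone_graph f (g v) (h v)].
Proof.
move=> cg ch.
have -> : [set v | monotone_graph f (g v) (h v)] =
    \bigcap_u ((g @^-1` [set z | z <= u] `|` h @^-1` [set z | f u <= z]) `&`
               (g @^-1` [set z | u <= z] `|` h @^-1` [set z | z <= f u])).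
  apply/seteqP; split => [v [v1 v2] u _|v vP].
    split; [have [|/v1] := leP (g v) u|have [|/v2] := leP u (g v)].
    - by left. - by right. - by left. - by right.
  split => u; have [h1 h2] := vP u I => ug.
    by case: h1 => //=; rewrite leNgt ug.
  by case: h2 => //=; rewrite leNgt ug.
apply: closed_bigI => u _; apply: closedI; apply: closedU;
  apply: preimage_closed => //; first [exact: closed_le | exact: closed_ge | by move=> ? _; auto].
Qed.

(** * Dissipation and growth along trajectories *)

(** The pairs of a point in the box, far from consensus, and a Filippov selection form a compact
    set, on which the continuous dissipation attains its minimum. *)
Lemma dissipation_bounded_below (R : realType) (n : nat) (G : weighted_digraph R n)
    (f : 'I_n -> R -> R) (w : 'I_n -> R) (B e : R) :
  strongly_connected G -> (forall i, {homo f i : u v / u <= v}) ->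
  (forall i, 0 < w i) -> 0 < e ->
  exists2 eta, 0 < eta & forall x y : 'I_n -> R, (forall i, `|x i| <= B) ->
    (forall i, monotone_graph (f i) (x i) (y i)) ->
    (forall p a, (forall i, monotone_graph (f i) (p i) a) ->
       ~ (forall i, `|x i - p i| < e)) ->
    eta <= \sum_i \sum_j w i * adjacency G i j * (y i - y j) ^+ 2.
Proof.
move=> Gc f_nd w_gt0 e_gt0.
pose X i (v : 'rV[R]_n * 'rV[R]_n) := v.1 ord0 i.
pose Y i (v : 'rV[R]_n * 'rV[R]_n) := v.2 ord0 i.
have cX i : continuous (X i).
  move=> v; apply: (@continuous_comp _ _ _ fst (fun u : 'rV_n => u ord0 i)).
    exact: cvg_fst.
  exact: coord_continuous.
have cY i : continuous (Y i).
  move=> v; apply: (@continuous_comp _ _ _ snd (fun u : 'rV_n => u ord0 i)).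
    exact: cvg_snd.
  exact: coord_continuous.
(* The margin 1 in the bounds on [y] is there because [monotone_graph] compares only with points
   strictly on either side. *)
pose K1 := [set v : 'rV[R]_n | forall i, `[- B, B]%classic (v ord0 i)] `*`
           [set v : 'rV[R]_n | forall i, `[f i (- B - 1), f i (B + 1)]%classic (v ord0 i)].
have cK1 : compact K1.
  apply: compact_setX.
    by apply: (@rV_compact _ n (fun=> `[- B, B]%classic)) => i; exact: segment_compact.
  apply: (@rV_compact _ n (fun i => `[f i (- B - 1), f i (B + 1)]%classic)) => i.
  exact: segment_compact.
pose K2 := \bigcap_i [set v | monotone_graph (f i) (X i v) (Y i v)].
have cK2 : closed K2 by apply: closed_bigI => i _; exact: closed_monotone_graph.
pose K3 := \bigcap_(p in [set p : 'I_n -> R | exists a, forall i, monotone_graph (f i) (p i) a])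
  ~` [set v | forall i, `|X i v - p i| < e].
have cK3 : closed K3.
  apply: closed_bigI => p _; apply: open_closedC; rewrite openE => v /= vp.
  apply: (@filter_forall _ _ (fun i => [set u | `|X i u - p i| < e]) (nbhs v)) => i.
  have : \forall z \near X i v, `|z - p i| < e.
    have := vp i; rewrite distrC => vpi.
    have : nbhs (X i v) (ball (p i) e).
      by apply: open_nbhs_nbhs; split; [exact: ball_open|].
    by apply: filterS => z; rewrite /ball/= distrC.
  exact: cX.
pose K := K1 `&` K2 `&` K3.
have cK : compact K by apply: compact_closedI => //; exact: compact_closedI.
pose D v := \sum_i \sum_j w i * adjacency G i j * (Y i v - Y j v) ^+ 2.
have cD : continuous D.
  apply: continuous_big => [|i _]; first exact: add_continuous.
  apply: continuous_big => [|j _]; first exact: add_continuous.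
  move=> v; apply: cvgM; first exact: cvg_cst.
  by rewrite /GRing.exp/=; apply: cvgM; apply: cvgB; exact: cY.
have inK x y : (forall i, `|x i| <= B) ->
    (forall i, monotone_graph (f i) (x i) (y i)) ->
    (forall p a, (forall i, monotone_graph (f i) (p i) a) ->
       ~ (forall i, `|x i - p i| < e)) -> K (\row_i x i, \row_i y i).
  move=> xB xy xD; split; [split; [split|]|].
  - by move=> i; rewrite /= mxE in_itv/= -ler_norml.
  - move=> i; rewrite /= mxE in_itv/=; have := xB i; rewrite ler_norml => /andP[h1 h2].
    by have [y1 y2] := xy i; rewrite y1 ?y2//; lra.
  - by move=> i _; rewrite /= /X /Y !mxE; exact: xy.
  - move=> p [a pa] /= xp; apply: (xD p a pa) => i.
    by have := xp i; rewrite /X/= mxE.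
have [K0|/set0P/negP] := pselect (K !=set0); last first.
  move=> /negPn/eqP K0; exists 1 => // x y xB xy xD.
  by have := inK x y xB xy xD; rewrite K0.
have [c /set_mem Kc cmin] := compact_EVT_min K0 cK (continuous_subspaceT cD).
have D_ge0 : 0 <= D c.
  apply: sumr_ge0 => i _; apply: sumr_ge0 => j _.
  by rewrite mulr_ge0 ?sqr_ge0// mulr_ge0 ?adjacency_ge0// ltW.
(* If the minimum were zero, the selection would be constant, and the minimizer would be a consensus
   point at distance 0 from itself. *)
exists (D c).
  rewrite lt_neqAle D_ge0 andbT eq_sym; apply/eqP => /(dissipation_eq0 Gc w_gt0)[a ya].
  have [[_ c2] c3] := Kc; apply: (c3 (X^~ c)).
    by exists a => i; rewrite -(ya i); exact: c2.
  by move=> i /=; rewrite subrr normr0.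
move=> x y xB xy xD; have := cmin _ (mem_set (inK _ _ xB xy xD)).
rewrite [X in _ <= X -> _](_ : _ = \sum_i \sum_j w i * adjacency G i j * (y i - y j) ^+ 2)//.
by apply: eq_bigr => i _; apply: eq_bigr => j _; rewrite /Y !mxE.
Qed.

Lemma derivable_approx (R : realType) (V : normedModType R) (x : R -> V) (t : R) :
  derivable x t 1 -> forall e, 0 < e -> exists2 d, 0 < d &
    forall s, `|t - s| < d -> `|x t - x s - (t - s) *: 'D_1 x t| <= e * `|t - s|.
Proof.
move=> xt e e_gt0.
have /cvgrPdist_le/(_ e e_gt0)/nbhs_ballP[d /= d_gt0 dP] :
  h^-1 *: (x (h *: 1 + t) - x t) @[h --> 0^'] --> 'D_1 x t := xt.
exists d => // s std.
have [->|st] := eqVneq s t; first by rewrite !subrr scale0r subr0 !normr0 mulr0.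
have st0 : s - t != 0 by rewrite subr_eq0.
have := dP (s - t); rewrite /ball/= sub0r opprB => /(_ std st0).
rewrite [_%:A]mulr1 subrK => /(ler_wpM2l (normr_ge0 (s - t))).
rewrite -normrZ scalerBr scalerA mulfV// scale1r => H.
rewrite [leRHS]mulrC (distrC t).
rewrite (_ : x t - x s - (t - s) *: 'D_1 x t =
    (s - t) *: 'D_1 x t - (x s - x t))//.
by rewrite -[t - s]opprB scaleNr opprK opprB addrC.
Qed.

(** Steps of length [d / 2] change [x] by less than 1 each, and finitely many of them reach [b]. *)
Lemma abs_continuous_bounded (R : realType) (V : normedModType R) (b : R)
    (x : R -> V) :
  abs_continuous 0 b x -> exists B, forall t, 0 <= t -> t <= b -> `|x t| <= B.
Proof.
move=> ac; have [d d_gt0 dP] := ac 1 ltr01.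
have step s t : 0 <= s -> s <= t -> t <= b -> t - s < d -> `|x t - x s| < 1.
  move=> s0 st tb std; have := dP 1%N (fun=> s) (fun=> t); rewrite !big_ord1; apply => //.
  by apply/trivIsetP => i j _ _; rewrite !ord1 eqxx.
have chain k t : 0 <= t -> t <= b -> t <= k%:R * (d / 2) -> `|x t| <= `|x 0| + k%:R.
  elim: k t => [|k IH] t t0 tb.
    rewrite mul0r => t0'.
    by rewrite (le_anti (introT andP (conj t0' t0))) addr0.
  rewrite -natr1 mulrDl mul1r addrA => tk.
  pose s := Num.max 0 (t - d / 2).
  have s0 : 0 <= s by rewrite le_max lexx.
  have st : s <= t by rewrite ge_max t0 gerBl divr_ge0// ltW.
  have ts : t - s < d by rewrite ltrBlDr -ltrBlDl lt_max; apply/orP; right; lra.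
  have xts := step _ _ s0 st tb ts.
  have IHs : `|x s| <= `|x 0| + k%:R.
    apply: IH => //; first exact: le_trans tb.
    by rewrite ge_max mulr_ge0 ?divr_ge0 ?(ltW d_gt0)//= lerBlDr.
  have := ler_normD (x s) (x t - x s); rewrite [x s + _]addrC subrK; lra.
pose k := Num.bound (`|b| / (d / 2)).
have kP : b <= k%:R * (d / 2).
  apply: le_trans (ler_norm _) _; rewrite -ler_pdivrMr ?divr_gt0//.
  by apply/ltW/archi_boundP; rewrite !divr_ge0// ltW.
by exists (`|x 0| + k%:R) => t t0 tb; apply: chain => //; exact: le_trans kP.
Qed.

Lemma abs_continuous_subinterval (R : realType) (V : normedModType R) (a b c : R)
  (x : R -> V) : a <= c -> abs_continuous a b x -> abs_continuous c b x.
Proof.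
move=> ac xac e e_gt0; have [d d_gt0 dP] := xac e e_gt0; exists d => // k u v uv.
by apply: dP => i; have [cu ? ?] := uv i; split => //; exact: le_trans cu.
Qed.

Lemma coord_le_norm (R : realType) (n : nat) (v : 'cV[R]_n) i : `|v i 0| <= `|v|.
Proof.
rewrite [leRHS]mx_normrE; exact: (le_bigmax _ (fun ij => `|v ij.1 ij.2|) (i, 0)).
Qed.

(** A one-sided chain rule: a subgradient [k] of [g] at [x t] bounds the increments over [[s, t]]
    from above, and differentiating [x] alone turns this into a bound on the left slopes of
    [g \o x]. It serves both the Lyapunov function and linear functionals. *)
Lemma subgradient_growth (R : realType) (n : nat) (a b c : R) (x : R -> 'cV[R]_n)
    (g : 'cV[R]_n -> R) (N : set R) :
  a <= b -> abs_continuous a b (g \o x : R -> R^o) ->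
  (@lebesgue_measure R).-negligible N ->
  (forall t, a < t -> t <= b -> ~ N t -> derivable x t 1 /\
     exists2 k : 'I_n -> R,
       forall s, s < t -> g (x t) - g (x s) <= \sum_i k i * (x t i 0 - x s i 0) &
       \sum_i k i * ('D_1 x t) i 0 <= c) ->
  g (x b) - g (x a) <= c * (b - a).
Proof.
move=> ab gac N0 gx; apply: (abs_continuous_slope_le ab gac N0) => t at_ tb Nt e e_gt0.
have [xt [k gk kc]] := gx t at_ tb Nt.
pose S := \sum_i `|k i|.
have S_ge0 : 0 <= S by apply: sumr_ge0.
have S1 : 0 < S + 1 by rewrite ltr_wpDl.
have [d d_gt0 dP] := derivable_approx xt (ltac:(by rewrite divr_gt0) : 0 < e / (S + 1)).
exists d => // s ds st; apply: le_trans (gk s st) _.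
have ts : 0 < t - s by rewrite subr_gt0.
have {dP} := dP s; rewrite gtr0_norm// => /(_ ltac:(lra)) Hx.
have Hi i : k i * (x t i 0 - x s i 0) <=
    (t - s) * (k i * ('D_1 x t) i 0) + `|k i| * (e / (S + 1) * (t - s)).
  rewrite -lerBlDl.
  have -> : k i * (x t i 0 - x s i 0) - (t - s) * (k i * ('D_1 x t) i 0) =
      k i * (x t - x s - (t - s) *: 'D_1 x t) i 0 by rewrite !mxE; ring.
  apply: le_trans (ler_norm _) _; rewrite normrM ler_wpM2l//.
  exact: le_trans (coord_le_norm _ _) Hx.
apply: le_trans (ler_sum _ (fun i _ => Hi i)) _.
rewrite big_split/= -mulr_sumr -mulr_suml -/S [(c + e) * _]mulrDl [(t - s) * _]mulrC lerD//.
  by rewrite ler_wpM2r// ltW.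
rewrite mulrA ler_wpM2r ?(ltW ts)// mulrCA ler_piMr ?(ltW e_gt0)//.
by rewrite ler_pdivrMr// mul1r lerDl.
Qed.

(** * Conservation, boundedness and convergence of solutions *)

Theorem mainTheorem1 (R : realType) (n : nat) (G : weighted_digraph R n)
    (f : 'I_n -> R -> R)
    (Gconnected : strongly_connected G)
    (f_increasing : forall i, {homo f i : a b / a <= b})
    (f_unbounded : forall i, `|f i z| @[z --> +oo] --> +oo)
    (x : R -> 'cV[R]_n)
    (x_solution : inclusion_solution
       (fun p => [set - (laplacian G *m y) | y in filippov_prod f p]) x) :
  converges_to_set x (consensus_set f).
Proof.
have [N N0 xN] : exists2 N : set R, (@lebesgue_measure R).-negligible N &
    forall t : R, 0 <= t -> ~ N t -> derivable x t 1 /\ exists2 y : 'I_n -> R,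
      forall i, monotone_graph (f i) (x t i 0) (y i) &
      forall i, ('D_1 x t) i 0 = - \sum_j adjacency G i j * (y i - y j).
  have [_ ae] := x_solution; eexists; first exact: ae.
  move=> t t0 /contrapT/(_ t0)[xt [y xy yD]]; split => //.
  exists (fun i => y i 0) => i; first exact/filippovE.
  by rewrite -yD mxE laplacianE.
have xac (b : R) : 0 <= b -> abs_continuous 0 b x by move=> b0; apply: x_solution.1.
clear x_solution.
have [w w_gt0 wE] := left_perron_vector Gconnected.
have /choice[F FP] : forall i, exists F, forall a b, f i a * (b - a) <= F b - F a.
  by move=> i; exact: nondecreasing_primitive.
pose V (p : 'cV[R]_n) := \sum_i w i * F i (p i 0).
pose diss y := \sum_i \sum_j w i * adjacency G i j * (y i - y j) ^+ 2.
(* The bound is asked for every Filippov selection at every time, hence for the one that drives the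
   solution almost everywhere. *)
have V_growth (a b c : R) : 0 <= a -> a <= b ->
    (forall (t : R) y, a < t -> t <= b ->
       (forall i, monotone_graph (f i) (x t i 0) (y i)) -> - (2^-1 * diss y) <= c) ->
    V (x b) - V (x a) <= c * (b - a).
  move=> a0 ab Vc; apply: (subgradient_growth ab _ N0).
    apply: (abs_continuous_subinterval a0).
    have xacb := xac b (le_trans a0 ab).
    have [B xB] := abs_continuous_bounded xacb.
    apply: (abs_continuous_lipschitz (K := \sum_i w i * (`|f i (- B)| + `|f i B|)) xacb).
    move=> s t s0 st tb; rewrite /= /V -sumrB mulr_suml.
    apply: le_trans (ler_norm_sum _ _ _) _; apply: ler_sum => i _.
    rewrite -mulrBr normrM (gtr0_norm (w_gt0 i)) -mulrA ler_pM2l//.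
    have xiB u : 0 <= u -> u <= b -> `|x u i 0| <= B.
      by move=> u0 ub; apply: le_trans (xB u u0 ub); exact: coord_le_norm.
    have := primitive_lipschitz (f_increasing i) (FP i)
      (xiB s s0 (le_trans st tb)) (xiB t (le_trans s0 st) tb).
    move=> /le_trans; apply; rewrite ler_wpM2l ?addr_ge0//.
    by have := coord_le_norm (x t - x s) i; rewrite !mxE.
  move=> t a_lt tb Nt; have t0 : 0 <= t by rewrite (le_trans a0)// ltW.
  have [xt [y xy yD]] := xN t t0 Nt; split => //.
  exists (fun i => w i * y i) => [s _|].
    rewrite /V -sumrB; apply: ler_sum => i _; rewrite -mulrBr -mulrA ler_pM2l//.
    have := primitive_subgradient (x s i 0) (FP i) (xy i).
    by rewrite -[x s i 0 - _]opprB mulrN; lra.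
  have := Vc t y a_lt tb xy; rewrite /diss -(dissipation _ wE) -sumrN.
  by move/(le_trans _); apply; apply: ler_sum => i _; rewrite yD mulrN mulrA.
have lin_growth (k : 'I_n -> R) (a b c : R) : 0 <= a -> a <= b ->
    (forall (t : R) y, a < t -> t <= b ->
       (forall i, monotone_graph (f i) (x t i 0) (y i)) ->
       - (\sum_i k i * \sum_j adjacency G i j * (y i - y j)) <= c) ->
    \sum_i k i * x b i 0 - \sum_i k i * x a i 0 <= c * (b - a).
  move=> a0 ab kc.
  apply: (subgradient_growth (g := fun p => \sum_i k i * p i 0) ab _ N0).
    apply: (abs_continuous_subinterval a0).
    apply: (abs_continuous_lipschitz (K := \sum_i `|k i|) (xac b (le_trans a0 ab))).
    move=> s t s0 st tb; rewrite /= -sumrB mulr_suml.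
    apply: le_trans (ler_norm_sum _ _ _) _; apply: ler_sum => i _.
    rewrite -mulrBr normrM ler_wpM2l//.
    by have := coord_le_norm (x t - x s) i; rewrite !mxE.
  move=> t a_lt tb Nt; have t0 : 0 <= t by rewrite (le_trans a0)// ltW.
  have [xt [y xy yD]] := xN t t0 Nt; split => //.
  exists k => [s _|]; first by rewrite -sumrB; apply: ler_sum => i _; rewrite mulrBr.
  have := kc t y a_lt tb xy; rewrite -sumrN.
  by move/(le_trans _); apply; apply: ler_sum => i _; rewrite yD mulrN.
pose m t := \sum_i w i * x t i 0.
(* [lin_growth] with weights [w] and [- w], both with bound 0. *)
have mE (t : R) : 0 <= t -> m t = m 0.
  move=> t0.
  have wL y : \sum_i w i * \sum_j adjacency G i j * (y i - y j) = 0.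
    under eq_bigr do rewrite mulr_sumr.
    transitivity (\sum_i \sum_j w i * adjacency G i j * y i -
                  \sum_i \sum_j w i * adjacency G i j * y j).
      rewrite -sumrB; apply: eq_bigr => i _; rewrite -sumrB; apply: eq_bigr => j _.
      ring.
    rewrite [X in _ - X]exchange_big/=; apply/eqP; rewrite subr_eq0; apply/eqP.
    by apply: eq_bigr => i _; rewrite -!mulr_suml wE mulr_sumr.
  have h1 := lin_growth w 0 t 0 (lexx 0) t0.
  have h2 := lin_growth (fun i => - w i) 0 t 0 (lexx 0) t0.
  rewrite !mul0r in h1 h2; rewrite /m; apply: le_anti; apply/andP; split.
    by rewrite -subr_le0; apply: h1 => s y _ _ _; rewrite wL oppr0.
  rewrite -subr_le0; have sN u : \sum_i - w i * x u i 0 = - \sum_i w i * x u i 0.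
    by rewrite -sumrN; apply: eq_bigr => i _; rewrite mulNr.
  move: h2; rewrite !sN opprK addrC; apply => s y _ _ _.
  by under eq_bigr do rewrite mulNr; rewrite sumrN wL !oppr0.
have diss_ge0 y : 0 <= diss y.
  apply: sumr_ge0 => i _; apply: sumr_ge0 => j _.
  by rewrite mulr_ge0 ?sqr_ge0// mulr_ge0 ?adjacency_ge0// ltW.
have V_le (s t : R) : 0 <= s -> s <= t -> V (x t) <= V (x s).
  move=> s0 st; have := V_growth s t 0 s0 st; rewrite mul0r subr_le0; apply.
  by move=> u y _ _ _; rewrite oppr_le0 mulr_ge0.
(* A single tilt that works for every [f i], so that the tilts add up to [l * m t], which is
   constant. *)
pose l : R := \sum_i `|f i 0| + 1.
have /choice[C CP] : forall i, exists C, forall b, l * b + `|b| - C <= F i b.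
  move=> i; apply: (primitive_coercive (f_increasing i) (f_unbounded i) (FP i)).
  rewrite /l lerD2r (le_trans (ler_norm _))// (bigD1 i)//= lerDl.
  exact: sumr_ge0.
pose V0 : R := l * m 0 - \sum_i w i * C i.
have V_coercive (t : R) : 0 <= t -> V0 + \sum_i w i * `|x t i 0| <= V (x t).
  move=> t0; rewrite /V0 -(mE t t0) /m mulr_sumr -sumrB -big_split/=.
  apply: ler_sum => i _.
  have -> : l * (w i * x t i 0) - w i * C i + w i * `|x t i 0| =
    w i * (l * x t i 0 + `|x t i 0| - C i) by ring.
  by rewrite ler_pM2l.
pose Q := V (x 0) - V0.
have sum_ge0 t : 0 <= \sum_i w i * `|x t i 0|.
  by apply: sumr_ge0 => i _; rewrite mulr_ge0// ltW.
have Q_ge0 : 0 <= Q.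
  by have := V_coercive 0 (lexx 0); have := sum_ge0 0; rewrite /Q; lra.
(* [Q] bounds the weighted sum of the [|x t i 0|]; this sum dominates each bound [Q / w i]. *)
pose B := \sum_i Q / w i.
have xB (t : R) i : 0 <= t -> `|x t i 0| <= B.
  move=> t0; have : w i * `|x t i 0| <= Q.
    have := V_coercive t t0; have := V_le 0 t (lexx 0) t0.
    rewrite [X in V0 + X](bigD1 i)//=.
    have : 0 <= \sum_(j | j != i) w j * `|x t j 0|.
      by apply: sumr_ge0 => j _; rewrite mulr_ge0// ltW.
    by rewrite /Q; lra.
  rewrite mulrC -ler_pdivlMr// => /le_trans; apply.
  rewrite /B (bigD1 i)//= lerDl; apply: sumr_ge0 => j _.
  by rewrite divr_ge0// ltW.
pose M : R := \sum_i (`|f i (- B - 1)| + `|f i (B + 1)|).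
have yM (t : R) y i : 0 <= t -> (forall i, monotone_graph (f i) (x t i 0) (y i)) ->
    `|y i| <= M.
  move=> t0 /(_ i)[y1 y2]; apply: (@le_trans _ _ (`|f i (- B - 1)| + `|f i (B + 1)|)).
    have := xB t i t0; rewrite ler_norml => /andP[xB1 xB2].
    have := y1 (- B - 1) ltac:(lra); have := y2 (B + 1) ltac:(lra).
    have := ler_norm (f i (B + 1)); have := ler_norm (- f i (- B - 1)).
    rewrite normrN ler_norml.
    by have := normr_ge0 (f i (B + 1)); have := normr_ge0 (f i (- B - 1)); lra.
  by rewrite /M (bigD1 i)//= lerDl; apply: sumr_ge0 => j _; rewrite addr_ge0.
pose K := \sum_i \sum_j adjacency G i j * (M + M) + 1.
have M_ge0 : 0 <= M by apply: sumr_ge0 => i _; rewrite addr_ge0.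
have K_gt0 : 0 < K.
  rewrite /K ltr_wpDl//; apply: sumr_ge0 => i _; apply: sumr_ge0 => j _.
  by rewrite mulr_ge0 ?adjacency_ge0// addr_ge0.
have DK (t : R) y i : 0 <= t -> (forall i, monotone_graph (f i) (x t i 0) (y i)) ->
    `|\sum_j adjacency G i j * (y i - y j)| <= K.
  move=> t0 xy; apply: le_trans (ler_norm_sum _ _ _) _.
  apply: (@le_trans _ _ (\sum_j adjacency G i j * (M + M))).
    apply: ler_sum => j _; rewrite normrM ger0_norm ?adjacency_ge0//.
    rewrite ler_wpM2l ?adjacency_ge0// (le_trans (ler_normB _ _))// lerD//.
    - exact: yM xy.
    - exact: yM xy.
  rewrite /K (bigD1 (F := fun i => \sum_j adjacency G i j * (M + M)) i)//= -addrA lerDl addr_ge0//.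
  apply: sumr_ge0 => k _; apply: sumr_ge0 => j _.
  by rewrite mulr_ge0 ?adjacency_ge0// addr_ge0.
(* [lin_growth] applied to plus and minus the [i]-th coordinate. *)
have x_lip (s t : R) i : 0 <= s -> s <= t -> `|x t i 0 - x s i 0| <= K * (t - s).
  move=> s0 st.
  have sE (r : R) (u : 'I_n -> R) : \sum_j (if j == i then r else 0) * u j = r * u i.
    rewrite (bigD1 i)//= eqxx big1 ?addr0// => j /negPf ->; exact: mul0r.
  have h1 := lin_growth (fun j => if j == i then 1 else 0) s t K s0 st.
  have h2 := lin_growth (fun j => if j == i then -1 else 0) s t K s0 st.
  rewrite !sE !mul1r in h1; rewrite !sE !mulN1r in h2.
  rewrite ler_norml; apply/andP; split.
    rewrite lerNl opprB -[X in X - _]opprK addrC h2// => u y su _ xy.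
    rewrite sE mulN1r opprK; apply: le_trans (ler_norm _) _; apply: DK xy.
    by rewrite (le_trans s0)// ltW.
  apply: h1 => u y su _ xy.
  rewrite sE mul1r; apply: le_trans (ler_norm _) _; rewrite normrN; apply: DK xy.
  by rewrite (le_trans s0)// ltW.
pose near_consensus (e t : R) := exists p a, (forall i, monotone_graph (f i) (p i) a) /\
  forall i : 'I_n, `|x t i 0 - p i| < e.
have x_near (e : R) : 0 < e -> exists T, forall t, T <= t -> near_consensus e t.
  move=> e_gt0; have e2 : 0 < e / 2 by rewrite divr_gt0.
  have [eta eta_gt0 etaP] :=
    dissipation_bounded_below B Gconnected f_increasing w_gt0 e2.
  apply: contrapT => never.
  have far T : exists2 t, T <= t & ~ near_consensus e t.
    apply: contrapT => h; apply: never; exists T => t Tt; apply: contrapT => ht.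
    by apply: h; exists t.
  (* In time [tau] no coordinate moves by more than [e / 2], so a state that is [e]-far from
     consensus stays [e / 2]-far. *)
  pose tau : R := e / 2 / K.
  have tau_gt0 : 0 < tau by rewrite divr_gt0.
  have drop k : exists2 t, 0 <= t & V (x t) <= V (x 0) - k%:R * (2^-1 * eta * tau).
    elim: k => [|k [t t0 IH]]; first by exists 0 => //; rewrite mul0r subr0.
    have [s ts sfar] := far t.
    have s0 := le_trans t0 ts; have s_tau : s <= s + tau by rewrite lerDl ltW.
    exists (s + tau); first by rewrite addr_ge0// ltW.
    have := V_growth s (s + tau) (- (2^-1 * eta)) s0 s_tau.
    have := V_le t s t0 ts; rewrite -(natr1 k) mulrDl mul1r mulNr.
    suff h : forall (u : R) y, s < u -> u <= s + tau ->
       (forall i, monotone_graph (f i) (x u i 0) (y i)) ->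
       - (2^-1 * diss y) <= - (2^-1 * eta).
      by move=> ? /(_ h); rewrite [s + tau - s]addrAC subrr add0r; lra.
    move=> u y su us xy; rewrite lerN2 ler_pM2l ?invr_gt0//.
    have u0 : 0 <= u by rewrite (le_trans s0)// ltW.
    apply: (etaP (fun i => x u i 0)) => // [i|p a pa xp]; first exact: xB.
    apply: sfar; exists p, a; split => // i.
    rewrite -(subrK (x u i 0) (x s i 0)) -addrA (le_lt_trans (ler_normD _ _))//.
    rewrite [e]splitr ler_ltD// distrC (le_trans (x_lip _ _ _ s0 (ltW su)))//.
    by rewrite mulrC -ler_pdivlMr// lerBlDl.
  have c_gt0 : 0 < 2^-1 * eta * tau by rewrite !mulr_gt0// invr_gt0.
  (* More drops than [Q] can pay for push [V] below its lower bound [V0]. *)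
  have [t t0] := drop (Num.bound (Q / (2^-1 * eta * tau))).
  have := archi_boundP (divr_ge0 Q_ge0 (ltW c_gt0)); rewrite ltr_pdivrMr//.
  by have := V_coercive t t0; have := sum_ge0 t; rewrite /Q; lra.
rewrite /converges_to_set => A A0.
(* A neighbourhood of 0 in the extended reals is tested on a real ball; aiming at [e / 2] gives the
   strict inequality. *)
have /nbhs_ballP[e /= e_gt0 eA] : \forall r \near (0 : R), A r%:E := A0.
have e2 : 0 < e / 2 by rewrite divr_gt0.
have [T TP] := x_near _ e2.
exists T; split; first exact: num_real.
move=> t Tt /=; have [p [a [pa xp]]] := TP t (ltW Tt).
have : (edist_inf (consensus_set f) (x t) <= (e / 2)%:E)%E.
  apply: (@le_trans _ _ (edist (x t, \col_i p i))).
    apply: ereal_inf_lbound; exists (\col_i p i) => //; exists a => i.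
    by rewrite !mxE; exact/filippovE.
  apply: edist_fin => //; split => // i j.
  by rewrite ord1 /ball/= mxE.
have := edist_inf_ge0 (consensus_set f) (x t).
case: (edist_inf _ _) => [r| |]; rewrite ?leye_eq ?lee_fin// => r0 re.
apply: eA; rewrite /ball/= sub0r normrN ger0_norm//.
by rewrite (le_lt_trans re)// gtr_pMr// invf_lt1// ltr1n.
Qed.
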